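(* Let $k$ be a field, $A$ an associative $k$-algebra, $B$ a commutative $k$-algebra and $\varepsilon:B\to A$ a morphism of $k$-algebras with $\varepsilon(B)\subset\mathcal Z(A)$. For $f^m\in C^m((A,B,\varepsilon);A)$ and $g^n\in C^n((A,B,\varepsilon);A)$ put $$[f^m,g^n]=f^m\circ g^n-(-1)^{(m-1)(n-1)}g^n\circ f^m .$$ Then this formula induces a well-defined bracket on $H^*((A,B,\varepsilon);A)=\bigoplus_{n\ge0}H^n((A,B,\varepsilon);A)$, and $\left(H^*((A,B,\varepsilon);A),[\cdot,\cdot]\right)$ is a graded Lie algebra, where the degree of an element of $H^m((A,B,\varepsilon);A)$ is $m-1$.
   Context: All algebras are unital, $\otimes=\otimes_k$, and $\mathcal Z(A)$ is the center of $A$. Secondary Hochschild complex. Put $C^n((A,B,\varepsilon);A)=\mathrm{Hom}_k(A^{\otimes n}\otimes B^{\otimes n(n-1)/2},A)$, with $C^0=A$. A pure tensor in $A^{\otimes n}\otimes B^{\otimes n(n-1)/2}$ is written as an upper triangular array $T=(a_i;b_{i,j})_{1\le i<j\le n}$ with diagonal entries $a_i\in A$ and entries $b_{i,j}\in B$ in position $(i,j)$, $i<j$. For $0\le p\le q\le n$, $T^p_q$ denotes the sub-array on the indices $p+1,\dots,q$, i.e. with diagonal entries $a_{p+1},\dots,a_q$ and off-diagonal entries $b_{i,j}$, $p+1\le i<j\le q$. For $T=(a_i;b_{i,j})_{1\le i<j\le n+1}$ and $1\le i\le n$, let $M_i(T)$ be the array of size $n$ obtained by merging the indices $i$ and $i+1$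 into one: the merged diagonal entry is $\varepsilon(b_{i,i+1})a_ia_{i+1}$; for $p<i$ the entry joining $p$ to the merged index is $b_{p,i}b_{p,i+1}$; for $q>i+1$ the entry joining the merged index to $q$ is $b_{i,q}b_{i+1,q}$; all other entries are unchanged. The differential $\delta^\varepsilon_n:C^n\to C^{n+1}$ is $$\delta^\varepsilon_n(f)(T)=a_1\varepsilon\Big(\prod_{j=2}^{n+1}b_{1,j}\Big)f(T^1_{n+1})+\sum_{i=1}^n(-1)^if(M_i(T))+(-1)^{n+1}f(T^0_n)a_{n+1}\varepsilon\Big(\prod_{i=1}^{n}b_{i,n+1}\Big),$$ and $\delta^\varepsilon_0(m)(a)=am-ma$. One has $\delta^\varepsilon_{n+1}\delta^\varepsilon_n=0$, and $H^n((A,B,\varepsilon);A)$ is the cohomology of this complex. Compositions. For $f\in C^m((A,B,\varepsilon);A)$, $g\in C^n((A,B,\varepsilon);A)$ and $0\le i\le m-1$, define $f\circ_ig\in C^{m+n-1}((A,B,\varepsilon);A)$ on $T=(a_p;b_{p,q})_{1\le p<q\le m+n-1}$ by $(f\circ_ig)(T)=f(T')$, where $T'$ is the array of size $m$ obtained from $T$ by replacing the block of indices $i+1,\dots,i+n$ by a single index: the diagonal of $T'$ is $a_1,\dots,a_i,\ g(T^i_{i+n}),\ a_{i+n+1},\dots,a_{m+n-1}$; for $p\le i$ the entry joining $p$ to the new index is $\prod_{i<j\le i+n}b_{p,j}$; for $q>i+n$ the entry joining the new index to $q$ is $\prod_{i<j\le i+n}b_{j,q}$; all entries $b_{p,q}$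 with $p,q$ both outside the block are unchanged (empty products equal $1$). Then $$f\circ g=\sum_{i=0}^{m-1}(-1)^{(n-1)i}f\circ_ig .$$ A graded Lie algebra is a graded $k$-vector space with a degree-preserving bilinear bracket satisfying, for homogeneous elements with degrees $|x|,|y|,|z|$, $[x,y]=-(-1)^{|x||y|}[y,x]$ and $(-1)^{|x||z|}[[x,y],z]+(-1)^{|y||x|}[[y,z],x]+(-1)^{|z||y|}[[z,x],y]=0$. *)

(* Defs.v *)
From HB Require Import structures.
From mathcomp Require Import all_boot all_order all_algebra.
From mathcomp Require Import boolp functions.

Set Implicit Arguments.
Unset Strict Implicit.
Unset Printing Implicit Defensive.

Import GRing.Theory.
Local Open Scope ring_scope.
Local Open Scope quotient_scope.

Section DirectSum.
Variables (R : pzRingType) (V : nat -> lmodType R).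

Definition finite_support (x : forall n, V n) : bool :=
  `[< exists N, forall n, (N <= n)%N -> x n = 0 >].

Record dsum := DSum { dsum_val :> forall n, V n; _ : finite_support dsum_val }.

HB.instance Definition _ := [isSub for dsum_val].
HB.instance Definition _ := [Choice of dsum by <:].

Lemma dsumP (x y : dsum) : (forall n, x n = y n) -> x = y.
Proof. by move=> exy; apply/val_inj/functional_extensionality_dep. Qed.

Lemma dsum_zero_subproof : finite_support (fun=> 0).
Proof. by apply/asboolP; exists 0%N. Qed.

Lemma dsum_opp_subproof (x : dsum) : finite_support (fun n => - x n).
Proof.
case: x => x /= /asboolP[N xN]; apply/asboolP; exists N => n leNn.
by rewrite xN // oppr0.
Qed.

Lemma dsum_add_subproof (x y : dsum) : finite_support (fun n => x n + y n).
Proof.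
case: x y => [x /= /asboolP[N xN]] [y /= /asboolP[M yM]].
apply/asboolP; exists (maxn N M) => n; rewrite geq_max => /andP[leNn leMn].
by rewrite xN // yM // addr0.
Qed.

Lemma dsum_scale_subproof (c : R) (x : dsum) :
  finite_support (fun n => c *: x n).
Proof.
case: x => x /= /asboolP[N xN]; apply/asboolP; exists N => n leNn.
by rewrite xN // scaler0.
Qed.

Definition dsum_zero : dsum := DSum dsum_zero_subproof.
Definition dsum_opp (x : dsum) : dsum := DSum (dsum_opp_subproof x).
Definition dsum_add (x y : dsum) : dsum := DSum (dsum_add_subproof x y).
Definition dsum_scale (c : R) (x : dsum) : dsum :=
  DSum (dsum_scale_subproof c x).

Fact dsum_addA : associative dsum_add.
Proof. by move=> x y z; apply: dsumP => n; apply: addrA. Qed.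

Fact dsum_addC : commutative dsum_add.
Proof. by move=> x y; apply: dsumP => n; apply: addrC. Qed.

Fact dsum_add0 : left_id dsum_zero dsum_add.
Proof. by move=> x; apply: dsumP => n; apply: add0r. Qed.

Fact dsum_addN : left_inverse dsum_zero dsum_opp dsum_add.
Proof. by move=> x; apply: dsumP => n; apply: addNr. Qed.

HB.instance Definition _ :=
  GRing.isZmodule.Build dsum dsum_addA dsum_addC dsum_add0 dsum_addN.

Fact dsum_scaleA c d (x : dsum) :
  dsum_scale c (dsum_scale d x) = dsum_scale (c * d) x.
Proof. by apply: dsumP => n; apply: scalerA. Qed.

Fact dsum_scale1 : left_id 1 dsum_scale.
Proof. by move=> x; apply: dsumP => n; apply: scale1r. Qed.

Fact dsum_scaleDr : right_distributive dsum_scale +%R.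
Proof. by move=> c x y; apply: dsumP => n; apply: scalerDr. Qed.

Fact dsum_scaleDl (x : dsum) : {morph dsum_scale^~ x : c d / c + d}.
Proof. by move=> c d; apply: dsumP => n; apply: scalerDl. Qed.

HB.instance Definition _ := GRing.Zmodule_isLmodule.Build R dsum
  dsum_scaleA dsum_scale1 dsum_scaleDr dsum_scaleDl.

Lemma dsum_in_subproof n (v : V n) : finite_support (@dfwith nat V (fun=> 0) n v).
Proof.
apply/asboolP; exists n.+1 => m ltnm.
by rewrite dfwith_out // neq_ltn ltnm.
Qed.

Definition dsum_in n (v : V n) : dsum := DSum (dsum_in_subproof v).

End DirectSum.

Section GradedLie.
Variables (k : fieldType) (L : lmodType k).
Implicit Types (G : int -> L -> Prop) (br : L -> L -> L).

(* G d x means that x is homogeneous of degree d. *)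
Record grading G : Prop := Grading {
  grading0 : forall d, G d 0;
  grading_linear : forall d (c : k) x y, G d x -> G d y -> G d (c *: x + y);
  grading_sum : forall x, exists (s : seq int) (y : int -> L),
    (forall d, G d (y d)) /\ x = \sum_(d <- s) y d;
  grading_direct : forall (s : seq int) (y : int -> L), uniq s ->
    (forall d, G d (y d)) -> \sum_(d <- s) y d = 0 -> {in s, forall d, y d = 0}
}.

Definition is_bilinear br : Prop :=
  (forall x, linear (br x)) /\ (forall y, linear (br^~ y)).

(* Koszul signs have integer exponents, since degrees may be negative. *)
Definition ksign (d : int) : k := (-1) ^ d.

Record graded_lie G br : Prop := GradedLie {
  graded_lie_grading : grading G;
  graded_lie_bilinear : is_bilinear br;
  graded_lie_degree : forall d e x y, G d x -> G e y -> G (d + e) (br x y);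
  graded_lie_antisymmetry : forall d e x y, G d x -> G e y ->
    br x y = - (ksign (d * e) *: br y x);
  graded_lie_jacobi : forall d e f x y z, G d x -> G e y -> G f z ->
    ksign (d * f) *: br (br x y) z + ksign (e * d) *: br (br y z) x
      + ksign (f * e) *: br (br z x) y = 0
}.

End GradedLie.

(* All indices start at 0, and not at 1. *)
Definition tri n := {p : 'I_n * 'I_n | (p.1 < p.2)%N}.

Section Arrays.
Variables (k : fieldType) (A : algType k) (B : comAlgType k).

Definition array n : Type := {ffun 'I_n -> A} * {ffun tri n -> B}.

(* Entries are read at natural number positions; the value 0 outside of the   *)
(* (strict) triangle is never used.                                           *)
Definition diag n (T : array n) (p : nat) : A :=
  if insub p is Some p' then T.1 p' else 0.

Definition off n (T : array n) (p q : nat) : B :=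
  if (insub p, insub q) is (Some p', Some q') then
    if insub (p', q') is Some e then T.2 e else 0
  else 0.

Definition mk_array n (a : nat -> A) (b : nat -> nat -> B) : array n :=
  ([ffun p : 'I_n => a p], [ffun e : tri n => b (val e).1 (val e).2]).

Definition set_diag n (T : array n) (p : 'I_n) (x : A) : array n :=
  ([ffun q => if q == p then x else T.1 q], T.2).

Definition set_off n (T : array n) (e : tri n) (y : B) : array n :=
  (T.1, [ffun e' => if e' == e then y else T.2 e']).

(* The sub-array on the n consecutive indices starting at p. *)
Definition sub_array p n r (T : array r) : array n :=
  mk_array n (fun i => diag T (p + i)) (fun i j => off T (p + i) (p + j)).

(* Replaces the block of indices i, ..., i + l - 1 by the single index i,     *)
(* with diagonal entry x; an index p > i of the result comes from the index   *)
(* p + l - 1 of T. The block may be empty (l = 0).                            *)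
Definition collapse m i l (x : A) r (T : array r) : array m :=
  mk_array m
    (fun p => if (p < i)%N then diag T p
              else if p == i then x else diag T (p + l).-1)
    (fun p q =>
       if (q < i)%N then off T p q
       else if q == i then \prod_(i <= j < i + l) off T p j
       else if (p < i)%N then off T p (q + l).-1
       else if p == i then \prod_(i <= j < i + l) off T j (q + l).-1
       else off T (p + l).-1 (q + l).-1).

(* A linear map on the tensor product of n copies of A and n(n-1)/2 copies of *)
(* B is encoded as a multilinear function of arrays, by its values on pure    *)
(* tensors.                                                                   *)
Definition multilinear n (f : array n -> A) : Prop :=
  (forall T p, linear (fun x : A => f (set_diag T p x))) /\
  (forall T e, linear (fun y : B => f (set_off T e y))).

Definition circ_at m n (f : array m -> A) (g : array n -> A) (i : nat) :
    array (m + n).-1 -> A :=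
  fun T => f (collapse m i n (g (sub_array i n T)) T).

(* If m = n = 0 the sum is empty, so that the value of circ in               *)
(* array (0 + 0).-1 -> A is 0, in accordance with C^(-1) = 0.                 *)
Definition circ m n (f : array m -> A) (g : array n -> A) :
    array (m + n).-1 -> A :=
  \sum_(i < m) ksign k ((n%:Z - 1) * i%:Z) *: circ_at f g i.

Definition gbracket m n (f : array m -> A) (g : array n -> A) :
    array (m + n).-1 -> A :=
  circ f g - ksign k ((m%:Z - 1) * (n%:Z - 1)) *:
    ecast r (array r -> A) (congr1 predn (addnC n m)) (circ g f).

End Arrays.

Section Cohomology.
Variables (k : fieldType) (A : algType k) (B : comAlgType k).
Variable eps : {lrmorphism B -> A}.
Local Notation array := (array A B).

Definition merge_array n (i : nat) (T : array n.+1) : array n :=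
  collapse n i 2 (eps (off T i i.+1) * diag T i * diag T i.+1) T.

(* For n = 0 this is delta m (a) = a * m - m * a. *)
Definition delta n (f : array n -> A) : array n.+1 -> A := fun T =>
  diag T 0 * eps (\prod_(1 <= j < n.+1) off T 0 j) * f (sub_array 1 n T)
  + \sum_(i < n) (-1) ^+ i.+1 *: f (merge_array i T)
  + (-1) ^+ n.+1 *: (f (sub_array 0 n T) * diag T n
                       * eps (\prod_(0 <= i < n) off T i n)).

Definition is_cocycle n (f : array n -> A) : bool :=
  `[< multilinear f /\ delta f = 0 >].

Lemma multilinear_closed n (c : k) (f g : array n -> A) :
  multilinear f -> multilinear g -> multilinear (c *: f + g).
Proof.
have step (U : lmodType k) (u v : U -> A) : linear u -> linear v ->
  linear (fun x => c *: u x + v x).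
  move=> lu lv d x y /=; rewrite lu lv !scalerDr !scalerA (mulrC c d).
  by rewrite addrACA.
by move=> [fA fB] [gA gB]; split=> T p; [apply: step|apply: step].
Qed.

Lemma multilinear0 n : multilinear (0 : array n -> A).
Proof. by split=> T p c x y /=; rewrite scaler0 addr0. Qed.

Lemma delta_linear n (c : k) (f g : array n -> A) :
  delta (c *: f + g) = c *: delta f + delta g.
Proof.
apply/funext => T.
have lcE U (h h' : U -> A) x : (c *: h + h') x = c *: h x + h' x by [].
rewrite lcE /delta !lcE.
set a := diag T 0 * _; set b := eps (\prod_(0 <= i < n) _).
have -> : \sum_(i < n) (-1) ^+ i.+1 *: (c *: f + g) (merge_array i T)
    = c *: (\sum_(i < n) (-1) ^+ i.+1 *: f (merge_array i T))
      + \sum_(i < n) (-1) ^+ i.+1 *: g (merge_array i T).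
  rewrite scaler_sumr -big_split; apply: eq_bigr => i _.
  by rewrite lcE scalerDr !scalerA (mulrC c).
rewrite mulrDr -scalerAr !mulrDl -!scalerAl scalerDr (scalerA _ c).
rewrite (mulrC _ c) -(scalerA c) !scalerDr [RHS]addrACA.
by congr (_ + _); rewrite [RHS]addrACA.
Qed.

Lemma delta0 n : delta (0 : array n -> A) = 0.
Proof.
have := delta_linear (- 1) 0 (0 : array n -> A).
by rewrite scaler0 addr0 => {1}->; rewrite scaleN1r addNr.
Qed.

Fact is_cocycle_submod n : submod_closed (@is_cocycle n).
Proof.
split=> [|c f g /asboolP[fM f0] /asboolP[gM g0]]; apply/asboolP; split.
- exact: multilinear0.
- exact: delta0.
- exact: multilinear_closed.
- by rewrite delta_linear f0 g0 scaler0 addr0.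
Qed.
HB.instance Definition _ n :=
  GRing.isSubmodClosed.Build k (array n -> A) (@is_cocycle n)
    (@is_cocycle_submod n).

Record cocycle n := Cocycle {
  cocycle_val :> array n -> A;
  _ : cocycle_val \in @is_cocycle n
}.
HB.instance Definition _ n := [isSub for @cocycle_val n].
HB.instance Definition _ n := [Choice of cocycle n by <:].
HB.instance Definition _ n :=
  [SubChoice_isSubLmodule of cocycle n by <:].

Definition coboundary n : (array n -> A) -> Prop :=
  if n is n'.+1 return (array n -> A) -> Prop then
    fun f => exists2 c : array n' -> A, multilinear c & f = delta c
  else fun f => f = 0.

Definition is_coboundary n (z : cocycle n) : bool := `[< coboundary z >].

Fact is_coboundary_submod n : submod_closed (@is_coboundary n).
Proof.
split=> [|c y z /asboolP yB /asboolP zB]; apply/asboolP.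
  by case: n => [|n] //; exists 0; [exact: multilinear0|rewrite delta0].
have -> : cocycle_val (c *: y + z) = c *: cocycle_val y + cocycle_val z.
  exact: (linearP (val : cocycle n -> array n -> A)).
case: n y z yB zB => [|n] y z /=; first by move=> -> ->; rewrite scaler0 addr0.
move=> [f fM ->] [g gM ->]; exists (c *: f + g); first exact: multilinear_closed.
by rewrite delta_linear.
Qed.
HB.instance Definition _ n :=
  GRing.isSubmodClosed.Build k (cocycle n) (@is_coboundary n)
    (@is_coboundary_submod n).

(* Since delta (delta c) = 0, the predicate is_coboundary on cocycle n cuts   *)
(* out the whole image of delta.                                              *)
Definition cohomology n : Type :=
  Quotient.quot (GRing.ZmodClosed.clone _ (@is_coboundary n) _).
HB.instance Definition _ n := ZmodQuotient.on (cohomology n).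

Definition coh_scale n (c : k) : cohomology n -> cohomology n :=
  lift_op1 (cohomology n) ( *:%R c).

Fact pi_scale n (c : k) (z : cocycle n) :
  coh_scale c (\pi_(cohomology n) z) = \pi_(cohomology n) (c *: z).
Proof.
unlock coh_scale; apply/eqP; rewrite -Quotient.idealrBE -scalerBr rpredZ //.
by rewrite Quotient.idealrBE reprK.
Qed.

Fact coh_scaleA n c d (x : cohomology n) :
  coh_scale c (coh_scale d x) = coh_scale (c * d) x.
Proof. by elim/quotW: x => z; rewrite !pi_scale scalerA. Qed.

Fact coh_scale1 n : left_id 1 (@coh_scale n).
Proof. by elim/quotW=> z; rewrite pi_scale scale1r. Qed.

Fact coh_scaleDr n : right_distributive (@coh_scale n) +%R.
Proof.
move=> c; elim/quotW=> y; elim/quotW=> z.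
have piD (u v : cocycle n) :
    \pi_(cohomology n) (u + v) = \pi_(cohomology n) u + \pi_(cohomology n) v.
  exact: raddfD.
by rewrite -piD !pi_scale -piD scalerDr.
Qed.

Fact coh_scaleDl n (x : cohomology n) :
  {morph (@coh_scale n)^~ x : c d / c + d}.
Proof. by elim/quotW: x => z c d; rewrite !pi_scale scalerDl raddfD. Qed.

HB.instance Definition _ n := GRing.Zmodule_isLmodule.Build k (cohomology n)
  (@coh_scaleA n) (@coh_scale1 n) (@coh_scaleDr n) (@coh_scaleDl n).

Definition coh_class n (z : cocycle n) : cohomology n :=
  \pi_(cohomology n) z.

Definition HH : Type := dsum cohomology.
HB.instance Definition _ := GRing.Lmodule.on HH.

(* H^n sits in degree n - 1. *)
Definition HH_degree (d : int) (x : HH) : Prop :=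
  forall n, n%:Z - 1 != d -> x n = 0.

Definition HH_class n (z : cocycle n) : HH :=
  dsum_in (V := cohomology) (coh_class z).

Record induced_bracket (br : HH -> HH -> HH) : Prop := InducedBracket {
  induced_bilinear : is_bilinear br;
  induced_class : forall m n (f : cocycle m) (g : cocycle n),
    exists2 h : cocycle (m + n).-1,
      cocycle_val h = gbracket f g & br (HH_class f) (HH_class g) = HH_class h
}.

End Cohomology.

(* Main.v *)
(* The compositions [f o_i g] satisfy the axioms of an operad, so the         *)
(* associator of the circle product is graded symmetric in its last two       *)
(* arguments: this is Gerstenhaber's pre-Lie identity, and it implies the     *)
(* graded Jacobi identity for cochains. Let [pi] be the cochain of arity 2    *)
(* given by [eps (b_12) a_1 a_2]. As [eps] is central, [delta f = - [f, pi]], *)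
(* so by the Jacobi identity a bracket of cocycles is a cocycle, and it is a  *)
(* coboundary if one of them is.                                              *)

Require Import Defs.
From mathcomp Require Import all_boot all_order all_algebra.
From mathcomp Require Import zify ring boolp functions.

Set Implicit Arguments.
Unset Strict Implicit.
Unset Printing Implicit Defensive.

Import GRing.Theory Num.Theory.
Local Open Scope ring_scope.

(** Insertion of one cochain into a slot of another obeys the operad axioms: [icirc_at_seq] for
    nested insertions and [icirc_at_par] for insertions into distinct slots. Both hold because the
    two sides merge the same blocks of indices. Sorting the slots of [F o_i G] into those left of,
    inside and right of [G] gives [icirc_assoc]. In the Jacobi sum each of three associators then
    occurs twice, with opposite signs ([ibracket_jacobi]).

    The differential is minus the bracket with the multiplication cochain [iprod] ([lift_delta]). By
    Jacobi, bracketing with a cocycle therefore commutes with the differential up to sign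
    ([ibracket_cocycle_diff]), so cocycles are closed under the bracket ([ibracket_cocycle]),
    coboundaries are absorbed by it ([icoboundary_bracketl]), and it descends to cohomology
    ([coh_bracketE]).

    The identities are proved for functions of infinite arrays and transferred along the injection
    [lift]. On the direct sum, [HH_homogeneous] reduces the axioms to classes of cocycles; these
    classes span, whence uniqueness. *)

(** * Linear maps and formal cancellations *)

Lemma linear_fun0 (R : pzRingType) (U V : lmodType R) (f : U -> V) :
  linear f -> f 0 = 0.
Proof.
move=> lf; have := lf (- 1) 0 0.
by rewrite scaler0 addr0 => {1}->; rewrite scaleN1r addNr.
Qed.

Lemma linear_funZ (R : pzRingType) (U V : lmodType R) (f : U -> V) (c : R) x :
  linear f -> f (c *: x) = c *: f x.
Proof. by move=> lf; rewrite -[c *: x]addr0 lf (linear_fun0 lf) addr0. Qed.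

Lemma linear_fun_sum (R : pzRingType) (U V : lmodType R) (f : U -> V)
    (I : Type) (r : seq I) (E : I -> U) :
  linear f -> f (\sum_(i <- r) E i) = \sum_(i <- r) f (E i).
Proof.
move=> lf; elim: r => [|i r IHr]; first by rewrite !big_nil linear_fun0.
by rewrite !big_cons -[E i]scale1r lf scale1r IHr scale1r.
Qed.

Lemma linear_comb (K : comPzRingType) (U V : lmodType K) (c : K)
    (u v : U -> V) :
  linear u -> linear v -> linear (fun x => c *: u x + v x).
Proof.
move=> lu lv d x y /=.
by rewrite lu lv !scalerDr !scalerA (mulrC c d) addrACA.
Qed.

(** The Jacobi sum without signs: [x1], ..., [x6] stand for the nested products such as
    [F o (G o H)], and [u], [v], [w] for the associators whose first argument is [F], [G], [H]. *)
Lemma cyclic_cancel (V : zmodType) (x1 x2 x3 x4 x5 x6 u v w : V) :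
  (x1 + u - (x2 + v) - x3 + x4) + (x5 + v - (x4 + w) - x1 + x6)
    + (x3 + w - (x6 + u) - x5 + x2) = 0.
Proof.
rewrite !opprD !addrA.
rewrite [LHS](ACl ((1*11)*(2*16)*(18*3)*(8*4)*(13*5)*(6*9)*(7*17)*(14*10)
  *(12*15))) /=.
by rewrite !subrr !addr0.
Qed.

(** Here [ab], [ac], [bc] are the Koszul signs of the pairs of arguments. Absorbing a sign into each
    of the nine vectors leaves [cyclic_cancel]. *)
Lemma jacobi_cancel (K : comPzRingType) (V : lmodType K) (ab ac bc : K)
    (x1 x2 x3 x4 x5 x6 u v w : V) :
    ab * ab = 1 -> ac * ac = 1 -> bc * bc = 1 ->
  ac *: (x1 + u - ab *: (x2 + ac *: v) - (ac * bc) *: x3 + (ac * bc * ab) *: x4)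
  + ab *: (x5 + v - bc *: (x4 + ab *: w) - (ab * ac) *: x1
           + (ab * ac * bc) *: x6)
  + bc *: (x3 + w - ac *: (x6 + bc *: u) - (bc * ab) *: x5
           + (bc * ab * ac) *: x2)
  = 0.
Proof.
move=> ab2 ac2 bc2.
rewrite -(cyclic_cancel (ac *: x1) ((ac * ab) *: x2) (bc *: x3)
  ((ab * bc) *: x4) (ab *: x5) ((ac * bc) *: x6) (ac *: u) (ab *: v) (bc *: w)).
rewrite !(scalerDr, scalerN, scalerA).
by do ?[congr (_ + _) | congr (- _)]; congr (_ *: _); ring: ab2 ac2 bc2.
Qed.

Lemma exchange_big_nat_triangle (V : nmodType) m (E : nat -> nat -> V) :
  \sum_(0 <= i < m) \sum_(i.+1 <= j < m) E i j =
  \sum_(0 <= j < m) \sum_(0 <= i < j) E i j.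
Proof.
elim: m => [|m IHm]; first by rewrite !big_nil.
rewrite big_nat_recr //= [X in _ + X]big_geq // addr0 big_nat_recr //= -IHm.
rewrite -big_split /=.
by apply: eq_big_nat => i /andP[_ ltim]; rewrite big_nat_recr.
Qed.

(** * Merging blocks of indices *)

Section BlockProducts.
Variable B : comPzSemiRingType.
Implicit Types (s t : nat -> nat) (b : nat -> nat -> B).

(* [s p] is the first index of the block that is merged into the index [p].   *)
(* By [push_comp], identities between compositions of cochains reduce to      *)
(* identities between such functions [s].                                     *)
Definition push s b : nat -> nat -> B := fun p q =>
  \prod_(s p <= i < s p.+1) \prod_(s q <= j < s q.+1) b i j.

Lemma prod_blocks s (F : nat -> B) p q : {homo s : x y / (x <= y)%N} ->
  (p <= q)%N ->
  \prod_(p <= i < q) \prod_(s i <= j < s i.+1) F j = \prod_(s p <= j < s q) F j.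
Proof.
move=> s_mono; elim: q => [|q IHq].
  by rewrite leqn0 => /eqP->; rewrite !big_geq.
rewrite leq_eqVlt => /predU1P[->|lepq]; first by rewrite !big_geq.
by rewrite big_nat_recr //= IHq // -big_cat_nat //=; apply: s_mono.
Qed.

Lemma push_comp s t b :
  {homo s : x y / (x <= y)%N} -> {homo t : x y / (x <= y)%N} ->
  push t (push s b) = push (s \o t) b.
Proof.
move=> s_mono t_mono; apply/funext => p; apply/funext => q.
rewrite /push /= -(prod_blocks _ s_mono (t_mono _ _ (leqnSn p))).
apply: eq_bigr => i _; rewrite exchange_big /=; apply: eq_bigr => i' _.
exact/prod_blocks/t_mono/leqnSn.
Qed.

Lemma eq_push s b b' p q :
    (forall i j, (s p <= i < s p.+1)%N -> (s q <= j < s q.+1)%N ->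
      b i j = b' i j) ->
  push s b p q = push s b' p q.
Proof.
by move=> eqb; apply: eq_big_nat => i ?; apply: eq_big_nat => j; apply: eqb.
Qed.

Definition set_entry b p q (y : B) : nat -> nat -> B := fun i j =>
  if (i == p) && (j == q) then y else b i j.

(** The entry at [(p, q)] lies in exactly one pair of blocks, [(u, v)], so [y] is a factor of one
    merged entry only. This makes compositions linear in off-diagonal entries. *)
Lemma push_set_entry s b p q y u v :
    (forall i, (s i <= p < s i.+1)%N = (i == u)) ->
    (forall j, (s j <= q < s j.+1)%N = (j == v)) ->
  push s (set_entry b p q y) =
  set_entry (push s (set_entry b p q 1)) u v
    (y * push s (set_entry b p q 1) u v).
Proof.
move=> pu qv; apply/funext => i; apply/funext => j.
suff -> : push s (set_entry b p q y) i j
    = (if (i == u) && (j == v) then y else 1) * push s (set_entry b p q 1) i j.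
  rewrite [in RHS]/set_entry; case: ifP => [/andP[/eqP-> /eqP->] //|_].
  by rewrite mul1r.
rewrite -pu -qv /push.
have splitE i' j' : set_entry b p q y i' j' =
     (if j' == q then if i' == p then y else 1 else 1)
       * set_entry b p q 1 i' j'.
  rewrite /set_entry.
  by case: (i' == p); case: (j' == q); rewrite /= ?mulr1 ?mul1r.
under eq_bigr => i' _.
  under eq_bigr do rewrite splitE.
  rewrite big_split /= -big_mkcond big_nat1_eq; over.
rewrite big_split /=; congr (_ * _).
rewrite (eq_bigr (fun i' => if i' == p then
   if (s j <= q < s j.+1)%N then y else 1 else 1)).
  by rewrite -big_mkcond big_nat1_eq; case: (s i <= p < _)%N.
by move=> i' _; case: (i' == p); case: ifP.
Qed.

End BlockProducts.

(* Only the [n] indices starting at [i] are merged; [block_of] maps an index  *)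
(* to the merged index that it becomes part of.                               *)
Definition block i n p : nat := if (p <= i)%N then p else (p + n).-1.

Lemma block_homo i n : {homo block i n : p q / (p <= q)%N}.
Proof. by move=> p q; rewrite /block; do ?case: ifP; lia. Qed.

Lemma addn_homo i : {homo addn i : p q / (p <= q)%N}.
Proof. by move=> p q; lia. Qed.

Definition block_of i n p : nat :=
  if (p < i)%N then p else if (p < i + n)%N then i else (p.+1 - n)%N.

Lemma mem_block i n p q :
  (block i n q <= p < block i n q.+1)%N = (q == block_of i n p).
Proof. by rewrite /block /block_of; do ?case: ifP => ?; lia. Qed.

(** * Cochains as functions of infinite arrays *)

Section InfiniteArrays.
Variables (k : fieldType) (A : algType k) (B : comAlgType k).

(* A cochain of any arity becomes a function of arrays indexed by all of      *)
(* [nat], of which it only reads the first entries. The arities are then      *)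
(* explicit arguments of the bracket and never occur in types.                *)
Definition iarray : Type := (nat -> A) * (nat -> nat -> B).
Implicit Types (T : iarray) (F G H : iarray -> A).

(** The blocks are singletons; [push] is used so that [push_comp] also applies to shifts. *)
Definition shift i T : iarray := (fun p => T.1 (i + p)%N, push (addn i) T.2).

Definition icollapse i n (x : A) T : iarray :=
  (fun p => if (p < i)%N then T.1 p else if p == i then x else T.1 (p + n).-1,
   push (block i n) T.2).

Definition icirc_at n F G i : iarray -> A :=
  fun T => F (icollapse i n (G (shift i T)) T).

Definition iset_diag T p x : iarray :=
  (fun q => if q == p then x else T.1 q, T.2).

Definition iset_off T p q y : iarray := (T.1, set_entry T.2 p q y).

Definition eq_upto n T T' : Prop :=
  (forall p, (p < n)%N -> T.1 p = T'.1 p) /\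
  (forall p q, (p < q < n)%N -> T.2 p q = T'.2 p q).

(** The arity is carried by locality: [F] reads only the first [n] diagonal entries and the strict
    triangle above them. *)
Record icochain n F : Prop := Icochain {
  icochain_local : forall T T', eq_upto n T T' -> F T = F T';
  icochain_diag : forall T p, (p < n)%N ->
    linear (fun x : A => F (iset_diag T p x));
  icochain_off : forall T p q, (p < q < n)%N ->
    linear (fun y : B => F (iset_off T p q y))
}.

Lemma shiftE i T :
  shift i T = (fun p => T.1 (i + p)%N, fun p q => T.2 (i + p)%N (i + q)%N).
Proof.
congr pair; apply/funext => p; apply/funext => q.
by rewrite /push !addnS !big_nat1.
Qed.

Lemma icollapse_set_diag i n x T :
  icollapse i n x T = iset_diag (icollapse i n 0 T) i x.
Proof.
by congr pair; apply/funext => p /=; case: ltngtP.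
Qed.

(** An entry inside the block acts through the value of [G], in which [F] is linear; any other entry
    is a diagonal entry, or a factor of one off-diagonal entry, of the collapsed array. *)
Lemma icochain_circ_at m n F G i : (i < m)%N ->
  icochain m F -> icochain n G -> icochain (m + n).-1 (icirc_at n F G i).
Proof.
move=> ltim [FL Fd Fo] [GL Gd Go]; split.
- move=> T T' [eqd eqo]; rewrite /icirc_at.
  have -> : G (shift i T) = G (shift i T').
    by apply: GL; rewrite !shiftE; split=> /= *; [apply: eqd|apply: eqo]; lia.
  apply: FL; split=> /= [p ltp|p q ltpq].
    by case: ltngtP => // ?; apply: eqd; lia.
  apply: eq_push => i' j' ip jq; apply: eqo; move: ip jq.
  by rewrite /block; do ?case: ifP => ?; lia.
- move=> T p ltp; case: (boolP (i <= p < i + n)%N) => [pin|pout].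
    have step x : icirc_at n F G i (iset_diag T p x) =
       F (iset_diag (icollapse i n 0 T) i
           (G (iset_diag (shift i T) (p - i)%N x))).
      rewrite /icirc_at icollapse_set_diag; congr F; congr pair.
      apply/funext => q /=.
        case: eqP => // qi; last first.
          by do ?case: ifP => ?; rewrite ?ifN //; lia.
        congr G; rewrite !shiftE; congr pair; apply/funext => r /=.
        by congr (if _ then _ else _); lia.
    move=> c x y; rewrite !step Gd; last by lia.
    by rewrite Fd.
  have step x : icirc_at n F G i (iset_diag T p x) =
      F (iset_diag (icollapse i n (G (shift i T)) T) (block_of i n p) x).
    rewrite /icirc_at; have -> : G (shift i (iset_diag T p x)) = G (shift i T).
      by apply: GL; rewrite !shiftE; split=> //= q ltq; rewrite ifN //; lia.
    congr F; congr pair; apply/funext => q /=; rewrite /block_of.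
    by case: (ltnP p i) => ?; [|case: (ltnP p (i + n)) => ?];
      (do ?case: ifP => ?); first [done | exfalso; lia].
  move=> c x y; rewrite !step Fd //; rewrite /block_of.
  by case: (ltnP p i) => ?; [lia|rewrite ifN; lia].
- move=> T p q ltpq; case: (boolP ((i <= p) && (q < i + n))%N) => [pqin|pqout].
    have step y : icirc_at n F G i (iset_off T p q y) =
       F (iset_diag (icollapse i n 0 T) i
           (G (iset_off (shift i T) (p - i)%N (q - i)%N y))).
      rewrite /icirc_at icollapse_set_diag; set x := G _; set x' := G _.
      have -> : x = x'.
        congr G; rewrite !shiftE; congr pair.
        apply/funext => p'; apply/funext => q' /=; rewrite /set_entry.
        by congr (if _ then _ else _); lia.
      (* Among the merged entries only the one at [(i, i)] contains [y], and [F] does not read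
         it. *)
      apply: FL; split=> //= p' q' ltpq'; apply: eq_push => i' j'.
      rewrite /set_entry => ip jq; rewrite ifN //; move: ip jq.
      by rewrite /block; do ?case: ifP => ?; lia.
    move=> c x y; rewrite !step Go; last by lia.
    by rewrite Fd.
  have step y : icirc_at n F G i (iset_off T p q y) =
      let Z := icollapse i n (G (shift i T)) (iset_off T p q 1) in
      F (iset_off Z (block_of i n p) (block_of i n q)
           (y * Z.2 (block_of i n p) (block_of i n q))).
    rewrite /icirc_at; have -> : G (shift i (iset_off T p q y)) = G (shift i T).
      apply: GL; rewrite !shiftE; split=> //= p' q' ltq.
      by rewrite /set_entry ifN //; lia.
    rewrite /=; congr F; congr pair.
    by apply: push_set_entry => j; apply: mem_block.
  move=> c x y; rewrite !step /= mulrDl -scalerAl Fo //.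
  rewrite /block_of; case: (ltnP p i) => ?; case: (ltnP q i) => ?; try lia.
    by case: ifP => ?; lia.
  by case: ifP => ?; case: ifP => ?; lia.
Qed.

(** The block of [H] lies inside that of [G], so merging it first does not change the outcome. *)
Lemma icirc_at_seq n p F G H i j : (j < n)%N ->
  icirc_at p (icirc_at n F G i) H (i + j) =
  icirc_at (n + p).-1 F (icirc_at p G H j) i.
Proof.
move=> ltjn; apply/funext => T; rewrite /icirc_at.
have -> : shift (i + j) T = shift j (shift i T).
  rewrite !shiftE; congr pair; apply/funext => q /=; first by rewrite addnA.
  by apply/funext => q' /=; rewrite !addnA.
set x := H _.
have -> : shift i (icollapse (i + j) p x T) = icollapse j p x (shift i T).
  congr pair => /=.
    apply/funext => q; rewrite ltn_add2l eqn_add2l.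
    by case: ltngtP => //= ltjq; congr (T.1 _); lia.
  rewrite !push_comp; try solve [exact: addn_homo | exact: block_homo].
  by congr push; apply/funext => q /=; rewrite /block leq_add2l; case: ifP; lia.
congr F; congr pair => /=.
  apply/funext => q.
  by do ?case: ifP => ?; first [done|congr (T.1 _); lia|exfalso; lia].
rewrite push_comp; [|exact: block_homo|exact: block_homo].
by congr push; apply/funext => q /=; rewrite /block; case: (leqP q i) => ?;
  do ?case: ifP => ?; lia.
Qed.

(** Inserting [G] at [i] moves slot [j] of [F] to [j + n - 1]. The block of [H] starts beyond the
    entries that [G] reads, so locality of [G] keeps its value unchanged. *)
Lemma icirc_at_par n p F G H i j : icochain n G -> (i < j)%N ->
  icirc_at p (icirc_at n F G i) H (j + n).-1 =
  icirc_at n (icirc_at p F H j) G i.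
Proof.
move=> [GL _ _] ltij; apply/funext => T; rewrite /icirc_at.
have -> : shift j (icollapse i n (G (shift i T)) T) = shift (j + n).-1 T.
  congr pair => /=.
    apply/funext => q; rewrite ifN; last lia; rewrite ifN; last lia.
    by congr (T.1 _); lia.
  rewrite push_comp; [|exact: block_homo|exact: addn_homo].
  by congr push; apply/funext => q /=; rewrite /block ifN; lia.
set x := H _.
have -> : G (shift i (icollapse (j + n).-1 p x T)) = G (shift i T).
  apply: GL; split=> /= [q ltq|q r ltqr]; first by rewrite ifT //; lia.
  rewrite push_comp; [|exact: block_homo|exact: addn_homo].
  rewrite /push /= /block; do ?[rewrite ifT; last lia].
  by rewrite !addnS !big_nat1.
set y := G _; congr F; congr pair => /=.
  apply/funext => q.
  by do ?case: ifP => ?; first [done|congr (T.1 _); lia|exfalso; lia].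
rewrite !push_comp; do ?exact: block_homo.
by congr push; apply/funext => q /=; rewrite /block; case: (leqP q i) => ?;
  case: (leqP q j) => ?; do ?case: ifP => ?; lia.
Qed.

(** * The pre-Lie identity and the Jacobi identity *)

(** The Koszul sign of the degrees [m - 1] and [n - 1]: successors have the same parity and avoid
    truncated subtraction at [0]. *)
Definition sgn (m n : nat) : k := (-1) ^+ (m.+1 * n.+1).

Definition icirc m n F G : iarray -> A :=
  \sum_(0 <= i < m) (-1 : k) ^+ (n.+1 * i) *: icirc_at n F G i.

Definition ibracket m n F G : iarray -> A :=
  icirc m n F G - sgn m n *: icirc n m G F.

Lemma sgnC m n : sgn m n = sgn n m.
Proof. by rewrite /sgn mulnC. Qed.

Lemma sgn_sqr m n : sgn m n * sgn m n = 1.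
Proof. by rewrite /sgn -expr2 sqrr_sign. Qed.

(** Degrees add under composition, except that the truncated predecessor breaks this for
    [m = n = 0]. *)
Lemma sgn_predD m n p : (0 < m + n)%N -> sgn (m + n).-1 p = sgn m p * sgn n p.
Proof.
move=> mn_gt0; rewrite /sgn -exprD -signr_odd -[RHS]signr_odd prednK //.
by rewrite oddD !oddM /= oddD; case: (odd m); case: (odd n); case: (odd p).
Qed.

Lemma icirc_at_suml n (I : Type) (r : seq I) (c : I -> k)
    (E : I -> iarray -> A) G i :
  icirc_at n (\sum_(j <- r) c j *: E j) G i =
  \sum_(j <- r) c j *: icirc_at n (E j) G i.
Proof. by apply/funext => T; rewrite /icirc_at !fct_sumE. Qed.

Lemma icirc_at_linear m n F i : (i < m)%N -> icochain m F ->
  linear (fun G => icirc_at n F G i).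
Proof.
move=> ltim [_ Fd _] c G G'; apply/funext => T.
have := Fd (icollapse i n 0 T) i ltim c (G (shift i T)) (G' (shift i T)).
by rewrite -!icollapse_set_diag.
Qed.

Lemma icirc_at_sumr m n F i (I : Type) (r : seq I) (c : I -> k)
    (E : I -> iarray -> A) :
    (i < m)%N -> icochain m F ->
  icirc_at n F (\sum_(j <- r) c j *: E j) i =
  \sum_(j <- r) c j *: icirc_at n F (E j) i.
Proof.
move=> ltim Fm; have lin := icirc_at_linear n ltim Fm.
elim: r => [|j r IHr]; last by rewrite !big_cons lin IHr.
by rewrite !big_nil; exact: linear_fun0 lin.
Qed.

Lemma icirc_linearl m n G : linear (fun F => icirc m n F G).
Proof.
move=> c F F'; rewrite /icirc scaler_sumr -big_split; apply: eq_bigr => i _ /=.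
by rewrite scalerA mulrC -scalerA -scalerDr.
Qed.

Lemma icirc_linearr m n F : icochain m F -> linear (icirc m n F).
Proof.
move=> Fm c G G'; rewrite /icirc scaler_sumr -big_split.
apply: eq_big_nat => i /andP[_ ltim] /=.
by rewrite (icirc_at_linear n ltim Fm) scalerDr !scalerA mulrC.
Qed.

(* The terms of [icirc (m + n).-1 p (icirc m n F G) H] in which [H] is        *)
(* inserted to the left of [G]. Those with [H] to the right of [G] are the    *)
(* same with [G] and [H] exchanged, so the associator below is graded         *)
(* symmetric in [G] and [H].                                                  *)
Definition icirc_left m n p F G H : iarray -> A :=
  \sum_(0 <= i < m) \sum_(0 <= l < i)
    (-1 : k) ^+ (p.+1 * l + n.+1 * i) *: icirc_at p (icirc_at n F G i) H l.

Lemma icirc_assoc m n p F G H : icochain m F -> icochain n G ->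
  icirc (m + n).-1 p (icirc m n F G) H =
  icirc m (n + p).-1 F (icirc n p G H)
  + (icirc_left m n p F G H + sgn n p *: icirc_left m p n F H G).
Proof.
move=> Fm Gn; pose E i l := (-1 : k) ^+ (p.+1 * l + n.+1 * i) *:
  icirc_at p (icirc_at n F G i) H l.
have -> : icirc (m + n).-1 p (icirc m n F G) H =
    \sum_(0 <= i < m) \sum_(0 <= l < (m + n).-1) E i l.
  rewrite exchange_big /=; apply: eq_bigr => l _.
  rewrite icirc_at_suml scaler_sumr; apply: eq_bigr => i _.
  by rewrite scalerA -exprD.
(* The slots left of, inside and right of [G]. The middle ones yield [F o (G o H)] by
   [icirc_at_seq]; the last ones are rewritten by [icirc_at_par]. *)
have split3 i : (0 <= i < m)%N -> \sum_(0 <= l < (m + n).-1) E i l =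
    \sum_(0 <= l < i) E i l + \sum_(0 <= j < n) E i (i + j)%N
      + \sum_(i.+1 <= j < m) E i (j + n).-1.
  move=> /andP[_ ltim].
  rewrite (@big_cat_nat _ _ _ i) //=; last by lia.
  rewrite (@big_cat_nat _ _ _ (i + n) i) //=; [|by lia|by lia].
  rewrite addrA; congr (_ + _ + _).
    rewrite -{1}[i]add0n big_addn addKn.
    by apply: eq_bigr => j _; rewrite addnC.
  rewrite -[(i + n)%N]add0n -[i.+1 in RHS]add0n !big_addn.
  rewrite (_ : (m + n).-1 - (i + n) = m - i.+1)%N; last by lia.
  by apply: eq_bigr => j _; congr (E i); lia.
rewrite (eq_big_nat _ _ split3) 2!big_split /= [X in X + _]addrC -addrA.
congr (_ + (_ + _)).
  rewrite /icirc; apply: eq_big_nat => i /andP[_ ltim].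
  rewrite (icirc_at_sumr _ _ _ _ ltim Fm) scaler_sumr.
  apply: eq_big_nat => j /andP[_ ltjn].
  rewrite /E (icirc_at_seq _ _ _ _ _ ltjn) scalerA -exprD; congr (_ *: _).
  rewrite -signr_odd -[RHS]signr_odd prednK; last by lia.
  rewrite !oddD !oddM /= !oddD; congr (_ ^+ _).
  by case: (odd i); case: (odd j); case: (odd n); case: (odd p).
rewrite /icirc_left scaler_sumr.
rewrite exchange_big_nat_triangle; apply: eq_big_nat => j /andP[_ ltjm].
rewrite scaler_sumr; apply: eq_big_nat => i /andP[_ ltij].
rewrite /E (icirc_at_par _ _ _ Gn ltij) scalerA /sgn -exprD; congr (_ *: _).
rewrite -signr_odd -[RHS]signr_odd; congr (_ ^+ _).
rewrite !oddD !oddM /= (_ : odd (j + n).-1 = ~~ odd (j + n)); last by lia.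
by rewrite oddD; case: (odd i); case: (odd j); case: (odd n); case: (odd p).
Qed.

(** The pre-Lie identity, with the associator written exactly as in [icirc_assoc] so that the two
    cancel in the Jacobi sum. *)
Lemma icirc_assoc_swap m n p F G H :
    icochain m F -> icochain n G -> icochain p H ->
  icirc (m + p).-1 n (icirc m p F H) G =
  icirc m (n + p).-1 F (icirc p n H G)
  + sgn n p *: (icirc_left m n p F G H + sgn n p *: icirc_left m p n F H G).
Proof.
move=> Fm Gn Hp; rewrite icirc_assoc // addnC; congr (_ + _).
by rewrite scalerDr scalerA sgn_sqr scale1r addrC (sgnC p).
Qed.

Lemma icirc0r m n F : icochain m F -> icirc m n F 0 = 0.
Proof. by move=> Fm; apply/linear_fun0/icirc_linearr. Qed.

Lemma icirc0 n F G : icirc 0 n F G = 0.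
Proof. by rewrite /icirc big_geq. Qed.

Lemma ibracket00 F G : ibracket 0 0 F G = 0.
Proof. by rewrite /ibracket !icirc0 scaler0 subr0. Qed.

Lemma ibracket_linearl m n G :
  icochain n G -> linear (fun F => ibracket m n F G).
Proof.
move=> Gn c F F'; rewrite /ibracket icirc_linearl icirc_linearr //.
rewrite scalerDr opprD addrACA scalerBr; congr (_ - _ + _).
by rewrite !scalerA mulrC.
Qed.

Lemma ibracketC m n F G : ibracket m n F G = - (sgn m n *: ibracket n m G F).
Proof.
by rewrite /ibracket scalerBr scalerA sgnC sgn_sqr scale1r opprB.
Qed.

Lemma ibracket_linearr m n F : icochain m F -> linear (ibracket m n F).
Proof.
move=> Fm c G G'; rewrite ibracketC ibracket_linearl // scalerDr opprD.
by rewrite scalerA mulrC -scalerA -scalerN -!ibracketC.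
Qed.

Lemma ibracket2E m n p F G H : icochain p H ->
  ibracket (m + n).-1 p (ibracket m n F G) H =
  icirc (m + n).-1 p (icirc m n F G) H
  - sgn m n *: icirc (n + m).-1 p (icirc n m G F) H
  - (sgn m p * sgn n p) *: icirc p (m + n).-1 H (icirc m n F G)
  + (sgn m p * sgn n p * sgn m n) *: icirc p (m + n).-1 H (icirc n m G F).
Proof.
move=> Hp; rewrite {1}/ibracket.
have sgnE : sgn (m + n).-1 p *: icirc p (m + n).-1 H (ibracket m n F G) =
    (sgn m p * sgn n p) *: icirc p (m + n).-1 H (ibracket m n F G).
  (* For [m = n = 0] the sign rule fails, but the inner bracket is zero. *)
  have [mn0|mn_gt0] := posnP (m + n); last by rewrite sgn_predD.
  have [-> ->] : m = 0%N /\ n = 0%N by lia.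
  by rewrite ibracket00 icirc0r // !scaler0.
rewrite sgnE /ibracket [icirc m n F G - _]addrC -!scaleNr.
rewrite icirc_linearl icirc_linearr //.
rewrite scalerDr scalerA mulrNN (addnC n) !addrA.
by rewrite [LHS](ACl (2*1*4*3)).
Qed.

Lemma ibracket_jacobi m n p F G H :
    icochain m F -> icochain n G -> icochain p H ->
  sgn m p *: ibracket (m + n).-1 p (ibracket m n F G) H
  + sgn n m *: ibracket (n + p).-1 m (ibracket n p G H) F
  + sgn p n *: ibracket (p + m).-1 n (ibracket p m H F) G = 0.
Proof.
move=> Fm Gn Hp; rewrite !ibracket2E //.
rewrite (icirc_assoc p H Fm Gn) (icirc_assoc m F Gn Hp) (icirc_assoc n G Hp Fm).
rewrite (icirc_assoc_swap Fm Gn Hp) (icirc_assoc_swap Gn Hp Fm).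
rewrite (icirc_assoc_swap Hp Fm Gn).
rewrite (sgnC n m) (sgnC p m) (sgnC p n) (addnC p m).
by apply: jacobi_cancel; apply: sgn_sqr.
Qed.

(** * Closure of cochains under composition and bracket *)

Lemma icochain0 n : icochain n 0.
Proof. by split=> // *; move=> c x y; rewrite scaler0 addr0. Qed.

Lemma icochain_comb n c F G :
  icochain n F -> icochain n G -> icochain n (c *: F + G).
Proof.
move=> [FL Fd Fo] [GL Gd Go]; split=> [T T' eqT|T p ltp|T p q ltpq].
- by rewrite !fctE (FL _ _ eqT) (GL _ _ eqT).
- exact: linear_comb (Fd T p ltp) (Gd T p ltp).
- exact: linear_comb (Fo T p q ltpq) (Go T p q ltpq).
Qed.

Lemma icochainZ n c F : icochain n F -> icochain n (c *: F).
Proof. by move=> Fn; rewrite -[c *: F]addr0; apply/icochain_comb/icochain0. Qed.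

Lemma icochain_circ m n F G : icochain m F -> icochain n G ->
  icochain (m + n).-1 (icirc m n F G).
Proof.
move=> Fm Gn; rewrite /icirc big_nat; apply: big_ind => [||i /andP[_ ltim]].
- exact: icochain0.
- by move=> F' G' F'n; rewrite -[F' in F' + _]scale1r; apply: icochain_comb.
- exact/icochainZ/icochain_circ_at.
Qed.

Lemma icochain_bracket m n F G : icochain m F -> icochain n G ->
  icochain (m + n).-1 (ibracket m n F G).
Proof.
move=> Fm Gn; rewrite /ibracket addrC -scaleNr; apply: icochain_comb.
  by rewrite addnC; apply: icochain_circ.
exact: icochain_circ.
Qed.

(** * Comparison with cochains on finite arrays *)

Definition truncate n T : array A B n := mk_array n T.1 T.2.
Definition extend n (T : array A B n) : iarray := (diag T, off T).

Lemma diag_truncate n T p : (p < n)%N -> diag (truncate n T) p = T.1 p.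
Proof. by move=> ltpn; rewrite /diag insubT /= ffunE. Qed.

Lemma off_truncate n T p q : (p < q < n)%N -> off (truncate n T) p q = T.2 p q.
Proof.
move=> /andP[ltpq ltqn]; have ltpn := ltn_trans ltpq ltqn.
rewrite /off (insubT (fun i => i < n)%N ltpn) (insubT (fun i => i < n)%N ltqn).
by rewrite insubT /= ffunE.
Qed.

Lemma eq_mk_array n (a a' : nat -> A) (b b' : nat -> nat -> B) :
    (forall p, (p < n)%N -> a p = a' p) ->
    (forall p q, (p < q < n)%N -> b p q = b' p q) ->
  mk_array n a b = mk_array n a' b'.
Proof.
move=> eqd eqo; congr pair; apply/ffunP => e; rewrite !ffunE; first exact: eqd.
by apply: eqo; rewrite (valP e) /=.
Qed.

Lemma extendK n : cancel (@extend n) (truncate n).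
Proof.
move=> T; rewrite [RHS]surjective_pairing.
congr pair; apply/ffunP => e; rewrite ffunE /=.
  by rewrite /diag valK.
by rewrite /off !valK -surjective_pairing valK.
Qed.

(** Being injective, it lets identities of finite cochains be checked on infinite arrays, where
    casts between arities disappear ([lift_ecast]). *)
Definition lift n (f : array A B n -> A) : iarray -> A :=
  fun T => f (truncate n T).

Lemma lift_inj n : injective (@lift n).
Proof.
move=> f g eqfg; apply/funext => T; rewrite -[T]extendK.
exact: (congr1 (fun F : iarray -> A => F _) eqfg).
Qed.

Lemma lift_local n (f : array A B n -> A) T T' :
  eq_upto n T T' -> lift f T = lift f T'.
Proof. by move=> [eqd eqo]; congr f; apply: eq_mk_array. Qed.

Lemma truncate_set_diag n T (p : 'I_n) x :
  truncate n (iset_diag T p x) = set_diag (truncate n T) p x.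
Proof. by congr pair; apply/ffunP => q; rewrite !ffunE. Qed.

Lemma truncate_set_off n T (e : tri n) y :
  truncate n (iset_off T (val e).1 (val e).2 y) = set_off (truncate n T) e y.
Proof.
congr pair; apply/ffunP => e'; rewrite !ffunE /= /set_entry.
by congr (if _ then _ else _).
Qed.

Lemma multilinear_lift n (f : array A B n -> A) :
  multilinear f <-> icochain n (lift f).
Proof.
split=> [[fd fo]|[_ Fd Fo]]; split.
- exact: lift_local.
- move=> T p ltp c x y.
  rewrite /lift -[p]/(val (Ordinal ltp)) !truncate_set_diag.
  exact: fd.
- move=> T p q /andP[ltpq ltqn] c x y; have ltpn := ltn_trans ltpq ltqn.
  pose e : tri n := exist _ (Ordinal ltpn, Ordinal ltqn) ltpq.
  rewrite /lift -[p]/(val (val e).1 : nat) -[q]/(val (val e).2 : nat).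
  rewrite !truncate_set_off.
  exact: fo.
- move=> T p c x y; rewrite -[T]extendK -!truncate_set_diag.
  exact: Fd.
- move=> T e c x y; rewrite -[T]extendK -!truncate_set_off.
  by apply: Fo; rewrite (valP e) /=.
Qed.

(** A free [r] makes this serve [merge_array] too, whose arity [n.+1] is not convertible to
    [(n + 2).-1]. *)
Lemma collapse_truncate m i n r x T : (i < m)%N -> r = (m + n).-1 ->
  collapse m i n x (truncate r T) = truncate m (icollapse i n x T).
Proof.
move=> ltim ->; apply: eq_mk_array => /= [p ltpm|p q /andP[ltpq ltqm]].
  by case: ltngtP => // ?; rewrite diag_truncate //; lia.
have le_block s : (s <= i)%N -> block i n s = s by rewrite /block => ->.
have gt_block s : (i <= s)%N -> block i n s.+1 = (s + n)%N.
  by move=> leis; rewrite /block ltnNge leis.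
rewrite /push; case: (ltngtP q i) => [ltqi|ltiq|eqqi].
- by rewrite !le_block ?big_nat1 ?off_truncate //; lia.
- case: q ltpq ltqm ltiq => // q ltpq ltqm leiq.
  rewrite (gt_block q leiq) (gt_block q.+1 (leqW leiq)) addSn /=.
  case: (ltngtP p i) => [ltpi|ltip|->].
  + by rewrite !le_block ?big_nat1 ?off_truncate //; lia.
  + case: p ltip ltpq => // p leip ltpq.
    rewrite (gt_block p leip) (gt_block p.+1 (leqW leip)).
    by rewrite addSn !big_nat1 off_truncate //; lia.
  + rewrite le_block // gt_block //; apply: eq_big_nat => j ltj.
    by rewrite big_nat1 off_truncate //; lia.
- rewrite eqqi in ltpq ltqm *.
  rewrite (le_block p) ?(le_block p.+1) ?(le_block i) ?(gt_block i) //;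
    rewrite ?big_nat1; try lia.
  apply: eq_big_nat => j ltj; rewrite off_truncate //; lia.
Qed.

Lemma sub_array_truncate i n r T : (i + n <= r)%N ->
  sub_array i n (truncate r T) = truncate n (shift i T).
Proof.
move=> le_r; rewrite shiftE; apply: eq_mk_array => /= [p ltpn|p q ltpq].
  by rewrite diag_truncate //; lia.
by rewrite off_truncate //; lia.
Qed.

(** Trades integer exponents for natural ones, through [(m-1)(n-1) = (m+1)(n+1) - 2(m+n)] and
    [(n-1)i = (n+1)i - 2i]. *)
Lemma ksign_even (a : nat) (b d : int) : d = a%:Z - 2%:Z * b ->
  ksign k d = (-1) ^+ a.
Proof.
move=> ->; rewrite /ksign expfzDr ?oppr_eq0 ?oner_eq0 // -mulrN -exprz_exp.
by rewrite -[(-1) ^ 2%:Z]/((-1) ^+ 2) sqrrN expr1n exp1rz mulr1.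
Qed.

Lemma ksign_sgn m n : ksign k ((m%:Z - 1) * (n%:Z - 1)) = sgn m n.
Proof. by apply: (@ksign_even _ (m%:Z + n%:Z)); lia. Qed.

Lemma lift_circ m n (f : array A B m -> A) (g : array A B n -> A) :
  lift (circ f g) = icirc m n (lift f) (lift g).
Proof.
apply/funext => T; rewrite /lift /circ /icirc big_mkord !fct_sumE.
apply: eq_bigr => i _; rewrite (@ksign_even (n.+1 * i) i); last by lia.
rewrite /=; congr (_ *: _).
rewrite /circ_at /icirc_at /lift (collapse_truncate _ _ (ltn_ord i)) //.
by rewrite sub_array_truncate //; have := ltn_ord i; lia.
Qed.

Lemma lift_ecast m n (e : m = n) (f : array A B m -> A) :
  lift (ecast r (array A B r -> A) e f) = lift f.
Proof. by case: n / e. Qed.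

Lemma lift_comb n c (f g : array A B n -> A) :
  lift (c *: f + g) = c *: lift f + lift g.
Proof. by []. Qed.

Lemma lift_gbracket m n (f : array A B m -> A) (g : array A B n -> A) :
  lift (gbracket f g) = ibracket m n (lift f) (lift g).
Proof.
rewrite /gbracket addrC -scaleNr lift_comb lift_ecast !lift_circ ksign_sgn.
by rewrite addrC scaleNr.
Qed.
End InfiniteArrays.

(** * The differential as a bracket *)

Section Differential.
Variables (k : fieldType) (A : algType k) (B : comAlgType k).
Variable eps : {lrmorphism B -> A}.
Hypothesis eps_central : forall (b : B) (a : A), eps b * a = a * eps b.

Definition iprod : iarray A B -> A := fun T => eps (T.2 0 1) * T.1 0 * T.1 1.

Lemma icochain_prod : icochain 2 iprod.
Proof.
split=> [T T' [eqd eqo]|T p ltp2 c x y|T p q ltpq2 c x y].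
- by rewrite /iprod !eqd ?eqo.
- case: p ltp2 => [|[|//]] _; rewrite /iprod /=.
    by rewrite mulrDr mulrDl -scalerAr -scalerAl.
  by rewrite mulrDr -scalerAr.
- have [-> ->] : p = 0%N /\ q = 1%N by lia.
  by rewrite /iprod /= linearP !mulrDl -!scalerAl.
Qed.

(** The two slots of [iprod] give the outer terms of the differential, where centrality moves [eps]
    into place; inserting [iprod] into [f] gives the merges. *)
Lemma lift_delta n (f : array A B n -> A) :
  lift (delta eps f) = - ibracket n 2 (lift f) iprod.
Proof.
have collapse0 T : icirc_at n iprod (lift f) 0 T =
    lift f T * T.1 n * eps (\prod_(0 <= i < n) T.2 i n).
  rewrite /icirc_at /iprod /= /push /block /= !add0n add1n -eps_central mulrA.
  by rewrite shiftE -surjective_pairing; under eq_bigr do rewrite big_nat1.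
have collapse1 T : icirc_at n iprod (lift f) 1 T =
    T.1 0 * eps (\prod_(1 <= j < n.+1) T.2 0 j) * lift f (shift 1 T).
  rewrite /icirc_at /iprod /= /push /block /= big_nat1 add1n eps_central.
  by [].
rewrite /ibracket opprB; apply/funext => T.
have -> : (sgn k n 2 *: icirc 2 n iprod (lift f) - icirc n 2 (lift f) iprod) T =
    sgn k n 2 *: icirc 2 n iprod (lift f) T - icirc n 2 (lift f) iprod T by [].
have sgnE : sgn k n 2 = (-1) ^+ n.+1.
  by rewrite /sgn mulnC exprM -[(-1) ^+ 3]/(-1 * (-1 * -1)) mulrNN !mulr1.
rewrite {1}/icirc fct_sumE 2?big_nat_recr //= big_geq //.
rewrite muln0 muln1 expr0 scale1r.
rewrite add0r scalerDr sgnE.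
rewrite {1}/lift /delta diag_truncate //.
rewrite scalrfctE scalerA -expr2 sqrr_sign scale1r collapse0 collapse1.
rewrite !sub_array_truncate // diag_truncate //.
have -> : \prod_(1 <= j < n.+1) off (truncate n.+1 T) 0 j =
    \prod_(1 <= j < n.+1) T.2 0%N j.
  by apply: eq_big_nat => j ltj; rewrite off_truncate //; lia.
have -> : \prod_(0 <= j < n) off (truncate n.+1 T) j n =
    \prod_(0 <= j < n) T.2 j n.
  by apply: eq_big_nat => j ltj; rewrite off_truncate //; lia.
rewrite addrAC [X in _ = X - _]addrC; congr (_ + _ + _).
  by rewrite /lift shiftE -surjective_pairing.
rewrite /icirc fct_sumE big_mkord -sumrN; apply: eq_bigr => i _.
have ltin := ltn_ord i.
rewrite scalrfctE /icirc_at /merge_array /lift.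
rewrite off_truncate ?diag_truncate ?collapse_truncate //; try lia.
rewrite /iprod shiftE /= addn0 addn1 exprS mulN1r scaleNr exprM.
by rewrite -[(-1) ^+ 3]/(-1 * (-1 * -1)) mulrNN !mulr1.
Qed.

(** * Brackets of cocycles and coboundaries *)

Lemma scaler_sgn_eq0 (V : lmodType k) m n (x : V) : sgn k m n *: x = 0 -> x = 0.
Proof.
by move=> sx; rewrite -[x]scale1r -(sgn_sqr k m n) -scalerA sx scaler0.
Qed.

Lemma ibracket0l m n (G : iarray A B -> A) :
  icochain n G -> ibracket m n 0 G = 0.
Proof.
by move=> Gn; apply: linear_fun0 (ibracket_linearl m Gn).
Qed.

(** The Jacobi identity for [F], [iprod], [G], in which the term containing the bracket of [iprod]
    and [G] vanishes. *)
Lemma ibracket_cocycle_diff m n (F G : iarray A B -> A) :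
    icochain m F -> icochain n G -> ibracket n 2 G iprod = 0 ->
  ibracket (m + 2).-1 n (ibracket m 2 F iprod) G =
  - (sgn k m n * sgn k n 2) *: ibracket (n + m).-1 2 (ibracket n m G F) iprod.
Proof.
move=> Fm Gn dG; have := ibracket_jacobi Fm icochain_prod Gn.
rewrite [ibracket 2 n _ _]ibracketC dG scaler0 oppr0 ibracket0l //.
rewrite scaler0 addr0.
move=> /eqP; rewrite addr_eq0 => /eqP/(congr1 ( *:%R (sgn k m n))).
by rewrite scalerA sgn_sqr scale1r scalerN scalerA scaleNr.
Qed.

Lemma ibracket_cocycle m n (F G : iarray A B -> A) :
    icochain m F -> icochain n G ->
    ibracket m 2 F iprod = 0 -> ibracket n 2 G iprod = 0 ->
  ibracket (m + n).-1 2 (ibracket m n F G) iprod = 0.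
Proof.
move=> Fm Gn dF dG; have := ibracket_cocycle_diff Gn Fm dF.
rewrite dG ibracket0l // => /esym/eqP.
rewrite scaleNr oppr_eq0 -scalerA => /eqP.
by move=> /scaler_sgn_eq0/scaler_sgn_eq0.
Qed.

Definition icoboundary n (F : iarray A B -> A) : Prop :=
  if n is n'.+1 then exists2 C, icochain n' C & F = ibracket n' 2 C iprod
  else F = 0.

Lemma icoboundaryZ n c F : icoboundary n F -> icoboundary n (c *: F).
Proof.
case: n => [->|n [C Cn ->]]; first exact: scaler0.
exists (c *: C); first exact: icochainZ.
by rewrite (linear_funZ _ _ (ibracket_linearl n icochain_prod)).
Qed.

Lemma icoboundary_bracketl m n (F G : iarray A B -> A) :
    icoboundary m F -> icochain n G -> ibracket n 2 G iprod = 0 ->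
  icoboundary (m + n).-1 (ibracket m n F G).
Proof.
case: m => [|m] /= bF Gn dG.
  rewrite bF ibracket0l //; case: (n.-1) => //= r.
  exists 0; first exact: icochain0.
  by rewrite ibracket0l //; apply: icochain_prod.
case: bF => C Cm ->; have := ibracket_cocycle_diff Cm Gn dG.
rewrite addn2 /= => ->; apply: icoboundaryZ.
(* The primitive is the bracket of [G] and [C]. If both have arity [0], the result has arity [0] and
   must vanish, which it does as that bracket is zero. *)
have [nm0|nm_gt0] := posnP (n + m).
  have [-> ->] : n = 0%N /\ m = 0%N by lia.
  by rewrite ibracket00 ibracket0l //; apply: icochain_prod.
rewrite addnC -{1}(prednK nm_gt0) /=; exists (ibracket n m G C) => //.
exact: icochain_bracket.
Qed.

Lemma icoboundary_bracketr m n (F G : iarray A B -> A) :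
    icochain m F -> ibracket m 2 F iprod = 0 -> icoboundary n G ->
  icoboundary (m + n).-1 (ibracket m n F G).
Proof.
move=> Fm dF bG; rewrite ibracketC -scaleNr addnC; apply: icoboundaryZ.
exact: icoboundary_bracketl.
Qed.

(** By locality, padding a finite array with default values loses nothing. *)
Lemma icochain_liftP n (F : iarray A B -> A) : icochain n F ->
  exists2 f : array A B n -> A, multilinear f & lift f = F.
Proof.
move=> Fn; have liftF : lift (F \o @extend k A B n) = F.
  apply/funext => T; apply: (icochain_local Fn).
  by split=> [p ltpn|p q ltpqn] /=; rewrite ?diag_truncate ?off_truncate.
by exists (F \o @extend k A B n); rewrite ?multilinear_lift liftF.
Qed.

Lemma coboundary_lift n (f : array A B n -> A) :
  coboundary eps f <-> icoboundary n (lift f).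
Proof.
case: n f => [|n] f /=.
  split=> [->//|f0]; exact: lift_inj.
split=> [[c cM ->]|[C Cn fE]].
  rewrite lift_delta; exists (- lift c).
    rewrite -scaleN1r; exact/icochainZ/multilinear_lift.
  by rewrite -!scaleN1r (linear_funZ _ _ (ibracket_linearl n icochain_prod)).
have [c cM cE] := icochain_liftP (icochainZ (- 1) Cn).
exists c => //; apply: lift_inj; rewrite lift_delta cE fE.
by rewrite (linear_funZ _ _ (ibracket_linearl n icochain_prod)) scaleN1r opprK.
Qed.

(** * The bracket on cohomology *)

Local Notation cocycle := (@cocycle k A B eps).
Local Notation cohomology := (@cohomology k A B eps).
Local Notation HH := (HH eps).

Lemma is_cocycleP n (f : array A B n -> A) :
  f \in @is_cocycle k A B eps n <->
  icochain n (lift f) /\ ibracket n 2 (lift f) iprod = 0.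
Proof.
rewrite unfold_in asboolE multilinear_lift.
have -> : (delta eps f = 0) <-> (ibracket n 2 (lift f) iprod = 0); last by [].
split=> [f0|f0].
  by apply/eqP; rewrite -oppr_eq0 -lift_delta f0.
by apply: lift_inj; rewrite lift_delta f0 oppr0.
Qed.

Lemma icocycle n (z : cocycle n) :
  icochain n (lift z) /\ ibracket n 2 (lift z) iprod = 0.
Proof. by apply/is_cocycleP; case: z. Qed.

Fact gbracket_cocycle m n (f : cocycle m) (g : cocycle n) :
  gbracket f g \in @is_cocycle k A B eps (m + n).-1.
Proof.
have [fm df] := icocycle f; have [gn dg] := icocycle g.
apply/is_cocycleP; rewrite lift_gbracket; split; first exact: icochain_bracket.
exact: ibracket_cocycle.
Qed.

Definition cocycle_bracket m n (f : cocycle m) (g : cocycle n) :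
    cocycle (m + n).-1 :=
  Cocycle (gbracket_cocycle f g).

Lemma lift_cocycle_bracket m n (f : cocycle m) (g : cocycle n) :
  lift (cocycle_bracket f g) = ibracket m n (lift f) (lift g).
Proof. exact: lift_gbracket. Qed.

Lemma cocycle_lift_inj n (z z' : cocycle n) : lift z = lift z' -> z = z'.
Proof. by move=> /lift_inj/val_inj. Qed.

Lemma lift_cocycle_comb n c (z z' : cocycle n) :
  lift (c *: z + z') = c *: lift z + lift z'.
Proof. by rewrite -lift_comb; congr lift. Qed.

Lemma cocycle_bracket_linearl m n (g : cocycle n) :
  linear (fun f : cocycle m => cocycle_bracket f g).
Proof.
move=> c f f'; apply: cocycle_lift_inj.
rewrite lift_cocycle_comb !lift_cocycle_bracket lift_cocycle_comb.
by apply: ibracket_linearl; have [] := icocycle g.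
Qed.

Lemma cocycle_bracket_linearr m n (f : cocycle m) :
  linear (fun g : cocycle n => cocycle_bracket f g).
Proof.
move=> c g g'; apply: cocycle_lift_inj.
rewrite lift_cocycle_comb !lift_cocycle_bracket lift_cocycle_comb.
by apply: ibracket_linearr; have [] := icocycle f.
Qed.

Lemma coh_class_linear n : linear (@coh_class k A B eps n).
Proof.
move=> c z z'.
have -> : coh_class (c *: z + z') = coh_class (c *: z) + coh_class z'.
  exact: raddfD.
by congr (_ + _); symmetry; exact: pi_scale.
Qed.

Lemma coh_class_eq n (z z' : cocycle n) :
  coh_class z = coh_class z' <-> icoboundary n (lift (z - z')).
Proof.
rewrite -coboundary_lift; split=> [/eqP|zz'].
  by rewrite -Quotient.idealrBE => /asboolP.
by apply/eqP; rewrite -Quotient.idealrBE; apply/asboolP.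
Qed.

Definition coh_bracket m n (x : cohomology m) (y : cohomology n) :
    cohomology (m + n).-1 :=
  coh_class (cocycle_bracket (repr x) (repr y)).

Lemma coh_bracketE m n (f : cocycle m) (g : cocycle n) :
  coh_bracket (coh_class f) (coh_class g) = coh_class (cocycle_bracket f g).
Proof.
rewrite /coh_bracket; set f' := repr _; set g' := repr _.
have [/coh_class_eq bf /coh_class_eq bg] :
    coh_class f' = coh_class f /\ coh_class g' = coh_class g.
  by rewrite /coh_class !reprK.
have [fm df] := icocycle f; have [g'n dg'] := icocycle g'.
(* One representative changes at a time, so each difference is a bracket of a cocycle with a
   coboundary. *)
transitivity (coh_class (cocycle_bracket f g')); apply/coh_class_eq.
  have -> : cocycle_bracket f' g' - cocycle_bracket f g' =
      cocycle_bracket (f' - f) g'.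
    by rewrite addrC -scaleN1r -cocycle_bracket_linearl scaleN1r addrC.
  by rewrite lift_cocycle_bracket; apply: icoboundary_bracketl.
have -> : cocycle_bracket f g' - cocycle_bracket f g =
    cocycle_bracket f (g' - g).
  by rewrite addrC -scaleN1r -cocycle_bracket_linearr scaleN1r addrC.
by rewrite lift_cocycle_bracket; apply: icoboundary_bracketr.
Qed.

Lemma coh_bracket_linearl m n (y : cohomology n) :
  linear (fun x : cohomology m => coh_bracket x y).
Proof.
move=> c; elim/quotW=> f; elim/quotW=> f'; elim/quotW: y => g.
have piE r (z : cocycle r) : \pi_(cohomology r)%qT z = coh_class z by [].
rewrite !piE -coh_class_linear !coh_bracketE -coh_class_linear.
by rewrite cocycle_bracket_linearl.
Qed.

Lemma coh_bracket_linearr m n (x : cohomology m) :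
  linear (fun y : cohomology n => coh_bracket x y).
Proof.
move=> c; elim/quotW=> g; elim/quotW=> g'; elim/quotW: x => f.
have piE r (z : cocycle r) : \pi_(cohomology r)%qT z = coh_class z by [].
rewrite !piE -coh_class_linear !coh_bracketE -coh_class_linear.
by rewrite cocycle_bracket_linearr.
Qed.

(** * The bracket on the direct sum *)

Lemma dsum_in_linear n r :
  linear (fun v : cohomology n => dsum_in (V := cohomology) v r).
Proof.
move=> c v w /=; case: (eqVneq n r) => [<-|nr]; first by rewrite !dfwith_in.
by rewrite !dfwith_out // scaler0 addr0.
Qed.

Lemma dsum_in0 n r : dsum_in (V := cohomology) (0 : cohomology n) r = 0.
Proof. exact: linear_fun0 (@dsum_in_linear n r). Qed.

Lemma dsum_in_out n (v : cohomology n) r :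
  n != r -> dsum_in (V := cohomology) v r = 0.
Proof. exact: dfwith_out. Qed.

Lemma dsum_in_in n (v : cohomology n) : dsum_in (V := cohomology) v n = v.
Proof. exact: dfwith_in. Qed.

Lemma HH_comb_coord c (x y : HH) n : (c *: x + y) n = c *: x n + y n.
Proof. by []. Qed.

Lemma HH_sum_coord (I : Type) (s : seq I) (F : I -> HH) n :
  (\sum_(i <- s) F i) n = \sum_(i <- s) F i n.
Proof. by elim/big_rec2: _ => // i y x _ <-. Qed.

(* If [(m + n).-1 = r] then [m] and [n] are less than [r.+2]; for other [m]   *)
(* and [n], the coordinate [r] of [dsum_in] is [0].                           *)
Definition HH_bracket_coord (x y : HH) r : cohomology r :=
  \sum_(0 <= m < r.+2) \sum_(0 <= n < r.+2)
    dsum_in (V := cohomology) (coh_bracket (x m) (y n)) r.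

Lemma coh_bracket0l m n (y : cohomology n) :
  coh_bracket (0 : cohomology m) y = 0.
Proof. exact: linear_fun0 (@coh_bracket_linearl m n y). Qed.

Lemma coh_bracket0r m n (x : cohomology m) :
  coh_bracket x (0 : cohomology n) = 0.
Proof. exact: linear_fun0 (@coh_bracket_linearr m n x). Qed.

Lemma HH_support (x : HH) : exists N, forall n, (N <= n)%N -> x n = 0.
Proof. by case: x => x /= /asboolP. Qed.

Lemma HH_bracket_subproof (x y : HH) : finite_support (HH_bracket_coord x y).
Proof.
have [M xM] := HH_support x; have [N yN] := HH_support y; apply/asboolP.
exists (M + N)%N => r ler; rewrite /HH_bracket_coord.
apply: big1_seq => m _; apply: big1_seq => n _.
have [rE|] := eqVneq (m + n).-1 r; last exact: dsum_in_out.
(* As [(m + n).-1] is at least [M + N], either [M <= m] or [N <= n]. *)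
have [leMm|ltmM] := leqP M m.
  by rewrite xM // coh_bracket0l dsum_in0.
by rewrite yN ?coh_bracket0r ?dsum_in0 //; lia.
Qed.

Definition HH_bracket (x y : HH) : HH := DSum (HH_bracket_subproof x y).

Lemma HH_bracketE (x y : HH) r : HH_bracket x y r = HH_bracket_coord x y r.
Proof. by []. Qed.

Lemma HH_bracket_bilinear : is_bilinear HH_bracket.
Proof.
split=> [x c y y'|y c x x']; apply: dsumP => r;
  rewrite HH_comb_coord !HH_bracketE /HH_bracket_coord;
  rewrite scaler_sumr -big_split; apply: eq_bigr => m _; cbn beta;
  rewrite scaler_sumr -big_split; apply: eq_bigr => n _; cbn beta;
  rewrite HH_comb_coord.
  by rewrite coh_bracket_linearr dsum_in_linear.
by rewrite coh_bracket_linearl dsum_in_linear.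
Qed.

Lemma HH_bracket_in m n (x : cohomology m) (y : cohomology n) :
  HH_bracket (dsum_in (V := cohomology) x) (dsum_in (V := cohomology) y)
  = dsum_in (V := cohomology) (coh_bracket x y).
Proof.
apply: dsumP => r; rewrite HH_bracketE /HH_bracket_coord.
have [rE|rN] := eqVneq (m + n).-1 r; last first.
  rewrite [RHS]dsum_in_out //; apply: big1_seq => m' _; apply: big1_seq => n' _.
  case: (eqVneq m m') => [<-|mm']; last first.
    by rewrite (dsum_in_out _ mm') coh_bracket0l dsum_in0.
  case: (eqVneq n n') => [<-|nn']; last first.
    by rewrite (dsum_in_out _ nn') coh_bracket0r dsum_in0.
  exact: dsum_in_out.
rewrite (bigD1_seq m) ?iota_uniq ?mem_index_iota //; last by lia.
rewrite (bigD1_seq n) ?iota_uniq ?mem_index_iota //; last by lia.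
rewrite !dsum_in_in big1 => [|n' nn']; last first.
  by rewrite [dsum_in y n']dsum_in_out 1?eq_sym // coh_bracket0r dsum_in0.
rewrite big1 => [|m' mm']; last first.
  apply: big1_seq => n' _.
  by rewrite [dsum_in x m']dsum_in_out 1?eq_sym // coh_bracket0l dsum_in0.
by rewrite /= !addr0.
Qed.

Lemma HH_bracket_class m n (f : cocycle m) (g : cocycle n) :
  HH_bracket (HH_class f) (HH_class g) = HH_class (cocycle_bracket f g).
Proof. by rewrite /HH_class HH_bracket_in coh_bracketE. Qed.

Lemma HH_class_linear n : linear (@HH_class k A B eps n).
Proof.
move=> c z z'; apply: dsumP => r.
rewrite HH_comb_coord /HH_class coh_class_linear.
exact: dsum_in_linear.
Qed.

Lemma HH_sum_in (x : HH) N : (forall n, (N <= n)%N -> x n = 0) ->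
  x = \sum_(0 <= n < N) dsum_in (V := cohomology) (x n).
Proof.
move=> xN; apply: dsumP => r; rewrite HH_sum_coord.
have [ltrN|leNr] := ltnP r N.
  rewrite (bigD1_seq r) ?iota_uniq ?mem_index_iota // dsum_in_in.
  rewrite big1 => [|n nr].
    by rewrite /= addr0.
  exact: dsum_in_out.
rewrite xN // big_nat big1 // => n ltnN; apply: dsum_in_out; lia.
Qed.

(** * Homogeneous elements and the graded Lie axioms *)

Lemma HH_in_class n (x : cohomology n) :
  dsum_in (V := cohomology) x = HH_class (repr x).
Proof. by rewrite /HH_class /coh_class reprK. Qed.

Lemma HH_homogeneous (d : int) (x : HH) : HH_degree d x ->
  x = 0 \/ exists n (z : cocycle n), d = n%:Z - 1 /\ x = HH_class z.
Proof.
move=> xd; have [d_ge|d_lt] := lerP 0 (d + 1); last first.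
  by left; apply: dsumP => n; apply: xd; lia.
right; pose n := absz (d + 1); exists n, (repr (x n)); split; first by lia.
rewrite -HH_in_class; apply: dsumP => r.
have [<-|nr] := eqVneq n r; first by rewrite dsum_in_in.
by rewrite dsum_in_out //; apply: xd; lia.
Qed.

Lemma HH_class_degree n (z : cocycle n) : HH_degree (n%:Z - 1) (HH_class z).
Proof. by move=> r rn; apply: dsum_in_out; apply: contraNneq rn => ->. Qed.

Lemma HH_grading : grading (@HH_degree k A B eps).
Proof.
split=> [d|d c x y xd yd n nd|x|s y s_uniq yd sum0 d ds].
- by [].
- by rewrite HH_comb_coord xd // yd // scaler0 addr0.
- have [N xN] := HH_support x.
  exists [seq n%:Z - 1 | n <- iota 0 N].
  (* Without the sign test, [absz] would place [x n] in degree [- n - 1] as well. *)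
  exists (fun d : int => if 0 <= d + 1
    then dsum_in (V := cohomology) (x (absz (d + 1))) else 0).
  split=> [d n nd|]; first by case: lerP => // d_ge; apply: dsum_in_out; lia.
  rewrite {1}(HH_sum_in xN) big_map -[N in iota _ N]subn0.
  apply: eq_bigr => n _.
  by rewrite subrK.
- apply: dsumP => n; have [dE|] := eqVneq (n%:Z - 1) d; last exact: yd.
  have : (\sum_(e <- s) y e) n = 0 by rewrite sum0.
  rewrite HH_sum_coord (bigD1_seq d) // big1 => [|e ed].
    by rewrite /= addr0.
  by apply: yd; rewrite dE eq_sym.
Qed.

(** Replaces casts between cocycle types. The second alternative covers brackets of two arity [0]
    cochains, where the arities really differ but the cochain is zero. *)
Lemma HH_class_transport n (z : cocycle n) N : n = N \/ lift z = 0 ->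
  exists2 z' : cocycle N, lift z' = lift z & HH_class z' = HH_class z.
Proof.
case=> [<-|z0]; first by exists z.
exists 0; first by rewrite z0.
have -> : z = 0 by apply: cocycle_lift_inj; rewrite z0.
by rewrite !(linear_fun0 (@HH_class_linear _)).
Qed.

Lemma HH_bracket0l y : HH_bracket 0 y = 0.
Proof. exact: linear_fun0 (HH_bracket_bilinear.2 y). Qed.

Lemma HH_bracket0r x : HH_bracket x 0 = 0.
Proof. exact: linear_fun0 (HH_bracket_bilinear.1 x). Qed.

Lemma HH_bracket_degree (d e : int) (x y : HH) :
  HH_degree d x -> HH_degree e y -> HH_degree (d + e) (HH_bracket x y).
Proof.
move=> /HH_homogeneous[->|[m [f [-> ->]]]]; first by rewrite HH_bracket0l.
move=> /HH_homogeneous[->|[n [g [-> ->]]]]; first by rewrite HH_bracket0r.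
(* For [m = n = 0] the degree should be [-2], while arity [0] has degree [-1]; the bracket
   vanishes. *)
rewrite HH_bracket_class; have [mn0|mn_gt0] := posnP (m + n).
  have [m0 n0] : m = 0%N /\ n = 0%N by lia.
  subst m n; rewrite (_ : cocycle_bracket f g = 0).
    by rewrite (linear_fun0 (@HH_class_linear _)).
  by apply: cocycle_lift_inj; rewrite lift_cocycle_bracket ibracket00.
rewrite (_ : _ + _ = (m + n).-1%:Z - 1); last by lia.
exact: HH_class_degree.
Qed.

Lemma HH_bracket_antisymmetry (d e : int) (x y : HH) :
  HH_degree d x -> HH_degree e y ->
  HH_bracket x y = - (ksign k (d * e) *: HH_bracket y x).
Proof.
move=> /HH_homogeneous[->|[m [f [-> ->]]]].
  by rewrite HH_bracket0l HH_bracket0r scaler0 oppr0.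
move=> /HH_homogeneous[->|[n [g [-> ->]]]].
  by rewrite HH_bracket0l HH_bracket0r scaler0 oppr0.
rewrite !HH_bracket_class ksign_sgn.
have [z zE <-] := HH_class_transport (z := cocycle_bracket g f)
  (or_introl (congr1 predn (addnC n m))).
rewrite -scaleNr -(linear_funZ _ _ (@HH_class_linear _)); congr HH_class.
apply: cocycle_lift_inj; rewrite -[_ *: z]addr0 lift_cocycle_comb addr0 zE.
by rewrite !lift_cocycle_bracket scaleNr; apply: ibracketC.
Qed.

(* If [m = n = 0] then [((m + n).-1 + p).-1], the arity of the iterated       *)
(* bracket, differs from [(m + n + p).-2], but the inner bracket vanishes.    *)
Lemma bracket2_transport m n p (f : cocycle m) (g : cocycle n) (h : cocycle p) :
  exists2 z : cocycle (m + n + p).-2,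
    lift z = ibracket (m + n).-1 p (ibracket m n (lift f) (lift g)) (lift h) &
    HH_class z = HH_bracket (HH_bracket (HH_class f) (HH_class g)) (HH_class h).
Proof.
rewrite !HH_bracket_class -!lift_cocycle_bracket; apply: HH_class_transport.
have [mn0|mn_gt0] := posnP (m + n); last by left; lia.
have [m0 n0] : m = 0%N /\ n = 0%N by lia.
right; rewrite !lift_cocycle_bracket; subst m n.
by rewrite ibracket00 ibracket0l //; have [] := icocycle h.
Qed.

Lemma HH_bracket_jacobi (d e c : int) (x y z : HH) :
  HH_degree d x -> HH_degree e y -> HH_degree c z ->
  ksign k (d * c) *: HH_bracket (HH_bracket x y) z
  + ksign k (e * d) *: HH_bracket (HH_bracket y z) x
  + ksign k (c * e) *: HH_bracket (HH_bracket z x) y = 0.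
Proof.
move=> /HH_homogeneous[->|[m [f [-> ->]]]].
  by rewrite !(HH_bracket0l, HH_bracket0r) !scaler0 !addr0.
move=> /HH_homogeneous[->|[n [g [-> ->]]]].
  by rewrite !(HH_bracket0l, HH_bracket0r) !scaler0 !addr0.
move=> /HH_homogeneous[->|[p [h [-> ->]]]].
  by rewrite !(HH_bracket0l, HH_bracket0r) !scaler0 !addr0.
have [fm _] := icocycle f; have [gn _] := icocycle g; have [hp _] := icocycle h.
have := ibracket_jacobi fm gn hp.
have [u <- <-] := bracket2_transport f g h.
have [v <- <-] := bracket2_transport g h f.
have [w <- <-] := bracket2_transport h f g.
(* Once the three double brackets share one arity, the identity of cochains passes to classes by
   linearity. *)
move: v w; rewrite (_ : n + p + m = m + n + p)%N; last by lia.
rewrite (_ : p + m + n = m + n + p)%N; last by lia.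
move=> v w; rewrite !ksign_sgn => jac.
rewrite -(linear_funZ _ w (@HH_class_linear _)) -addrA -!HH_class_linear.
rewrite [_ + _](_ : _ = 0) ?(linear_fun0 (@HH_class_linear _)) //.
apply: cocycle_lift_inj; rewrite !lift_cocycle_comb -[_ *: w]addr0.
rewrite lift_cocycle_comb.
by rewrite addr0 addrA.
Qed.

(** * Existence and uniqueness of the induced bracket *)

Lemma HH_bracket_induced : induced_bracket HH_bracket.
Proof.
split=> [|m n f g]; first exact: HH_bracket_bilinear.
by exists (cocycle_bracket f g); rewrite ?HH_bracket_class.
Qed.

(** Every element is a finite sum of classes of cocycles, on which the bracket is prescribed;
    bilinearity does the rest. *)
Lemma induced_bracket_unique (br : HH -> HH -> HH) :
  induced_bracket br -> HH_bracket = br.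
Proof.
case=> [[brl brr] br_class]; have [brl' brr'] := HH_bracket_bilinear.
have eq_class m n (f : cocycle m) (g : cocycle n) :
    HH_bracket (HH_class f) (HH_class g) = br (HH_class f) (HH_class g).
  have [h hE ->] := br_class m n f g; rewrite HH_bracket_class; congr HH_class.
  exact/val_inj/esym.
apply/funext => x; apply/funext => y.
have [M xM] := HH_support x; have [N yN] := HH_support y.
rewrite (HH_sum_in xM) (HH_sum_in yN).
rewrite (linear_fun_sum _ _ (brl _)) (linear_fun_sum _ _ (brl' _)).
apply: eq_bigr => n _.
rewrite (linear_fun_sum _ _ (brr _)) (linear_fun_sum _ _ (brr' _)).
by apply: eq_bigr => m _; rewrite !HH_in_class eq_class.
Qed.
End Differential.

Theorem theorem2p1 (k : fieldType) (A : algType k) (B : comAlgType k)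
    (eps : {lrmorphism B -> A})
    (eps_central : forall (b : B) (a : A), eps b * a = a * eps b) :
  exists br : HH eps -> HH eps -> HH eps,
    unique (@induced_bracket k A B eps) br
    /\ graded_lie (@HH_degree k A B eps) br.
Proof.
exists (HH_bracket eps_central); split.
  by split; [apply: HH_bracket_induced|apply: induced_bracket_unique].
split.
- exact: HH_grading.
- exact: HH_bracket_bilinear.
- exact: HH_bracket_degree.
- exact: HH_bracket_antisymmetry.
- exact: HH_bracket_jacobi.
Qed.
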